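(* Let $K$ be a field, $S=K[x_1,x_2]$, and let $I\subset S$ be a monomial ideal. Let $\mathcal{P}(S)$ be the set of monomial prime ideals of $S$. The following conditions are equivalent: (a) $I$ is polymatroidal. (b) For all $P\in\mathcal{P}(S)$ the ideal $I(P)$ has a linear resolution. (c) $I$ has a linear resolution.
   Context: For a monomial ideal $I$, $G(I)$ denotes its unique minimal set of monomial generators, and $\deg_{x_i}(u)$ is the exponent of $x_i$ in the monomial $u$. A monomial ideal $I$ is polymatroidal if it is generated in a single degree (all elements of $G(I)$ have the same degree) and, for all $u,v\in G(I)$ and every $i$ with $\deg_{x_i}(u)>\deg_{x_i}(v)$, there exists $j$ with $\deg_{x_j}(u)<\deg_{x_j}(v)$ such that $x_j(u/x_i)\in I$. Monomial prime ideals of $K[x_1,\ldots,x_n]$ are the ideals $P_C=(x_i : i\notin C)$ for $C\subseteq\{1,\ldots,n\}$ (here $n=2$). The monomial localization $I(P_C)$ is the monomial ideal obtained from $I$ by substituting $x_i\mapsto 1$ for all $i\in C$. A graded ideal $L$ has a linear resolution if for some $d$ it has a $d$-linear resolution, i.e. $\mathrm{Tor}_i^S(L,K)_j=0$ for all $i$ and all $j\neq i+d$. *)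

(* Defs.v *)
From mathcomp Require Import all_boot all_order all_algebra.
From mathcomp Require Export mpoly.

Set Implicit Arguments.
Unset Strict Implicit.
Unset Printing Implicit Defensive.

Import GRing.Theory.
Local Open Scope ring_scope.

Section MonomialIdeals.
Variables (n : nat) (K : fieldType).
Local Notation S := {mpoly K[n]}.

(* Unlike MathComp's [idealr_closed], the unit ideal is allowed. *)
Definition is_ideal (J : S -> Prop) : Prop :=
  [/\ J 0,
      forall p q, J p -> J q -> J (p + q)
    & forall a p, J p -> J (a * p)].

Definition ideal_gen (A : S -> Prop) : S -> Prop :=
  fun p => forall J, is_ideal J -> (forall q, A q -> J q) -> J p.

Definition monomials_generate (G : 'X_{1..n} -> Prop) (I : S -> Prop) : Prop :=
  forall p, I p <-> ideal_gen (fun q => exists2 m, G m & q = 'X_[m]) p.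

Definition monomial_ideal (I : S -> Prop) : Prop :=
  exists G, monomials_generate G I.

Definition min_monomial_gens (I : S -> Prop) (G : 'X_{1..n} -> Prop) : Prop :=
  monomials_generate G I /\
  forall G', (forall m, G' m -> G m) -> monomials_generate G' I ->
    forall m, G m -> G' m.

(* For a monomial ideal, the set G below exists and is unique: it is G(I). *)
Definition polymatroidal (I : S -> Prop) : Prop :=
  exists2 G, min_monomial_gens I G &
    (forall u v, G u -> G v -> mdeg u = mdeg v) /\
    (forall u v, G u -> G v -> forall i : 'I_n, (v i < u i)%N ->
       exists2 j : 'I_n, (u j < v j)%N & I 'X_[(U_(j) + (u - U_(i)))%MM]).

(* The monomial prime ideals P_C = (x_i : i \notin C) correspond bijectively
   to the sets C; I(P_C) is taken as an ideal of the whole ring S. *)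
Definition monomial_localization (I : S -> Prop) (C : {set 'I_n}) : S -> Prop :=
  ideal_gen (fun q => exists2 p, I p &
    q = p \mPo [tuple (if i \in C then 1 else 'X_i : S) | i < n]).

(* The data of an augmented sequence of Z-graded finite free modules
     ... -> F_1 -> F_0 -> S,   F_i = (+)_k S(- gshift i k).
   Elements of F_i are row vectors, on which matrices act on the right. *)
Record gfree_complex := GFreeComplex {
  grank  : nat -> nat;
  gshift : forall i, 'I_(grank i) -> int;
  gdiff  : forall i, 'M[S]_(grank i.+1, grank i);
  gaug   : 'cV[S]_(grank 0)
}.

(* A nonzero entry from S(-a) to S(-b) must be a form of degree a - b. *)
Definition gfree_resolution (F : gfree_complex) (L : S -> Prop) : Prop :=
  [/\ forall i k l m, m \in msupp (gdiff F i k l) ->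
        gshift k = (mdeg m)%:Z + gshift l,
      forall k m, m \in msupp (gaug F k 0) -> gshift k = (mdeg m)%:Z,
      forall p, L p <-> exists v : 'rV_(grank F 0), p = (v *m gaug F) 0 0,
      forall v : 'rV_(grank F 0),
        v *m gaug F = 0 <-> exists w, v = w *m gdiff F 0
    & forall i (v : 'rV_(grank F i.+1)),
        v *m gdiff F i = 0 <-> exists w, v = w *m gdiff F i.+1].

(* The complex F (x)_S K, with K = S/(x_1, ..., x_n): the matrices are replaced
   by their constant terms. *)
Definition tdiff (F : gfree_complex) (i : nat) :
    'M[K]_(grank F i.+1, grank F i) :=
  map_mx (mcoeff 0%MM) (gdiff F i).

Definition tdegree (F : gfree_complex) (i : nat) (j : int)
    (v : 'rV[K]_(grank F i)) : Prop :=
  forall k, gshift k != j -> v 0 k = 0.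

Definition tcycle (F : gfree_complex) (i : nat) :
    'rV[K]_(grank F i) -> Prop :=
  match i with
  | 0 => fun _ => True
  | i'.+1 => fun v => v *m tdiff F i' = 0
  end.

(* H_i(F (x)_S K)_j = 0 *)
Definition thomology_eq0 (F : gfree_complex) (i : nat) (j : int) : Prop :=
  forall v : 'rV[K]_(grank F i), tdegree j v -> tcycle v ->
    exists2 w : 'rV[K]_(grank F i.+1), tdegree j w & v = w *m tdiff F i.

(* Tor_i^S(L, K)_j = 0; by independence of Tor from the resolution, it does not
   matter which graded free resolution of L is used. *)
Definition Tor_eq0 (L : S -> Prop) (i : nat) (j : int) : Prop :=
  exists2 F, gfree_resolution F L & thomology_eq0 F i j.

Definition linear_resolution (L : S -> Prop) : Prop :=
  exists d : int, forall (i : nat) (j : int), j != i%:Z + d -> Tor_eq0 L i j.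

End MonomialIdeals.

(* Main.v *)
Require Import Defs.
From Stdlib Require Import Classical.
From mathcomp Require Import all_boot all_order all_algebra.
From mathcomp Require Import mpoly zify.

(**
Write X and Y for the two variables. All three conditions say that I is zero or
of the form X^a Y^b (X, Y)^r, and each implication goes through this form.

(a) => (b). Among the minimal generators of a nonzero polymatroidal ideal, take
the ones with the smallest and with the largest X-exponent. Applying the
exchange property to the pair formed by any other generator and the first one
changes X^k Y^l into X^(k-1) Y^(l+1), so every monomial of the generating degree
between the two extremes occurs, and I = X^a Y^b (X, Y)^r
([polymatroidal_power]). Setting X, Y or both to 1 in such an ideal gives an ideal of
the same form ([power_ideal_localization]), and X^a Y^b (X, Y)^r is resolved by
a complex of length one whose matrix has entries X, -Y and 0
([power_complex_resolution]).

(b) => (c). Substituting 1 for no variable at all gives back I.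

(c) => (a). Vanishing of Tor_i(I, K)_j has to be exploited for an arbitrary
graded free resolution, and a different one for each (i, j). Two statements that
do not mention resolutions are enough: if Tor_0(I, K)_j = 0, then every form of
degree j in I lies in (X, Y) I ([Tor0_eq0_gens]), and if Tor_1(I, K)_(e+2) = 0,
then every form s of degree e with X s and Y s in I lies in I
([Tor1_eq0_socle]; the Koszul complex identifies Tor_1(I, K) with the socle of
S/I, shifted by 2). By the first, a linear resolution forces all minimal
generators into one degree d. By the second, any monomial of degree at least d
that is a multiple of gcd (u, v), for u and v of degree d in I, lies in I:
descend from the degree of lcm (u, v), where u or v divides the monomial. The
exchange property is the special case X_j (u / X_i) ([linear_polymatroidal]).
*)

Set Implicit Arguments.
Unset Strict Implicit.
Unset Printing Implicit Defensive.

Import GRing.Theory.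
Local Open Scope ring_scope.

(** * Monomials and divisibility *)

Lemma ex_minimizer (T : Type) (P : T -> Prop) (f : T -> nat) :
  (exists x, P x) -> exists2 x, P x & forall y, P y -> (f x <= f y)%N.
Proof.
case=> x Px; have [k] := ubnP (f x); elim: k x Px => // k IHk x Px ltxk.
have [[y [Py ltyx]]|nolt] := classic (exists y, P y /\ (f y < f x)%N).
  by apply: (IHk y Py); lia.
exists x => // y Py; rewrite leqNgt; apply/negP => ltyx.
by apply: nolt; exists y.
Qed.

Section Monomials.
Variables (n : nat) (R : comNzRingType).
Implicit Types (p q : {mpoly R[n]}) (k m : 'X_{1..n}).

Definition mrestrict (P : pred 'X_{1..n}) p : {mpoly R[n]} :=
  \sum_(m <- msupp p | P m) p@_m *: 'X_[m].

Lemma mcoeff_mrestrict P p m : (mrestrict P p)@_m = if P m then p@_m else 0.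
Proof.
rewrite raddf_sum big_mkcond /=.
under eq_bigr do rewrite mcoeffZ mcoeffX.
have [msp|] := boolP (m \in msupp p); last first.
  rewrite -mcoeff_eq0 => /eqP pm0; rewrite pm0 if_same big1 // => k _.
  have [->|_] := eqVneq k m; first by rewrite pm0 mul0r if_same.
  by rewrite mulr0 if_same.
rewrite (bigD1_seq m) ?msupp_uniq //= eqxx mulr1 big1 ?addr0 // => k nekm.
by rewrite (negPf nekm) mulr0 if_same.
Qed.

Lemma mpolyX_dvd k p : (forall m, m \in msupp p -> (k <= m)%MM) ->
  exists q, p = 'X_[k] * q.
Proof.
move=> lekp; exists (\sum_(m <- msupp p) p@_m *: 'X_[m - k]).
rewrite {1}[p]mpolyE mulr_sumr; apply: eq_big_seq => m mp.
by rewrite -scalerAr -mpolyXD addmC submK // lekp.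
Qed.

Lemma msuppXM k p m :
  m \in msupp ('X_[k] * p) -> exists2 m', m' \in msupp p & m = (k + m')%MM.
Proof.
by rewrite mulrC (perm_mem (msuppMX _ _)) => /mapP [m' pm' ->]; exists m'.
Qed.
End Monomials.

Section Coprime.
Variables (n : nat) (K : fieldType).
Implicit Types (p q : {mpoly K[n]}) (a b m : 'X_{1..n}).

Lemma mpolyX_neq0 m : 'X_[m] != 0 :> {mpoly K[n]}.
Proof. by rewrite -msupp_eq0 msuppX. Qed.

(** The only syzygies between two coprime monomials are the Koszul ones. *)
Lemma mpolyX_coprime_cofactor a b p q :
    (forall i, minn (a i) (b i) = 0%N) -> 'X_[a] * p = 'X_[b] * q ->
  exists2 t, p = 'X_[b] * t & q = 'X_[a] * t.
Proof.
move=> cop eqpq.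
have [t pE] : exists t, p = 'X_[b] * t.
  apply: mpolyX_dvd => m pm; have : (a + m)%MM \in msupp ('X_[b] * q).
    by rewrite -eqpq mulrC mcoeff_msupp mcoeffMX -mcoeff_msupp.
  case/msuppXM => m' _ E; apply/mnm_lepP => i.
  by move/mnmP: E => /(_ i); rewrite !mnmDE; move: (cop i); lia.
exists t => //; apply: (mulfI (mpolyX_neq0 b)).
by rewrite -eqpq pE mulrCA.
Qed.
End Coprime.

(** * Monomial ideals, their minimal generators and localizations *)

Section Ideals.
Variables (n : nat) (K : fieldType).
Local Notation S := {mpoly K[n]}.
Implicit Types (I J : S -> Prop) (p q : S) (m g : 'X_{1..n}).

Definition supported_on (M : 'X_{1..n} -> Prop) : S -> Prop :=
  fun p => forall m, m \in msupp p -> M m.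

(** Every monomial ideal arises in this way; membership can then be read off the
    support, without handling generators. *)
Lemma supported_on_ideal (M : 'X_{1..n} -> Prop) :
  (forall m m', (m <= m')%MM -> M m -> M m') -> is_ideal (supported_on M).
Proof.
move=> upM; split=> [m|p q Mp Mq m|a p Mp m].
- by rewrite -mpolyC0 msupp0.
- by move/msuppD_le; rewrite mem_cat => /orP [/Mp|/Mq].
- case/msuppM_le/allpairsP => -[m1 m2] /= [_ pm2 ->].
  exact: upM (lem_addl _ _) (Mp _ pm2).
Qed.

Lemma ideal_gen_is_ideal (A : S -> Prop) : is_ideal (ideal_gen A).
Proof.
split=> [J [] //|p q Ap Aq J JI AJ|a p Ap J JI AJ]; case: (JI) => J0 JD JM.
  by apply: JD; [apply: Ap|apply: Aq].
by apply: JM; apply: Ap.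
Qed.

Lemma ideal_sum I (T : eqType) (r : seq T) (F : T -> S) :
  is_ideal I -> (forall x, x \in r -> I (F x)) -> I (\sum_(x <- r) F x).
Proof.
move=> [I0 ID _] IF; rewrite big_seq.
by elim/big_ind: _ => // x /IF.
Qed.

Lemma ideal_supportP I p :
  is_ideal I -> (forall m, m \in msupp p -> I 'X_[m]) -> I p.
Proof.
move=> idI Ip; rewrite [p]mpolyE; apply: ideal_sum => // m pm.
by case: idI => _ _ IM; rewrite -mul_mpolyC; apply/IM/Ip.
Qed.

Lemma ideal_mpolyX_le I m m' : is_ideal I -> (m <= m')%MM -> I 'X_[m] -> I 'X_[m'].
Proof. by case=> _ _ IM lemm' Im; rewrite -(submK lemm') mpolyXD; apply: IM. Qed.

Lemma monomials_generateP (G : 'X_{1..n} -> Prop) I :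
  monomials_generate G I <->
  forall p, I p <-> supported_on (fun m => exists2 g, G g & (g <= m)%MM) p.
Proof.
suff genE p : ideal_gen (fun q => exists2 m, G m & q = 'X_[m]) p <->
    supported_on (fun m => exists2 g, G g & (g <= m)%MM) p.
  by split=> H p; rewrite H; [apply: genE | apply: iff_sym; apply: genE].
split=> [genp|suppp].
  apply: genp => [|q [m Gm ->] m' /mem_msuppXP <-].
    apply: supported_on_ideal => m m' lemm' [g Gg legm].
    by exists g => //; apply: lepm_trans lemm'.
  by exists m => //; apply: lepm_refl.
apply: ideal_supportP (ideal_gen_is_ideal _) _ => m /suppp [g Gg legm].
apply: ideal_mpolyX_le (ideal_gen_is_ideal _) legm _ => J _; apply.
by exists g.
Qed.

Lemma monomial_ideal_is_ideal I : monomial_ideal I -> is_ideal I.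
Proof.
case=> G genI; case: (ideal_gen_is_ideal (fun q => exists2 m, G m & q = 'X_[m])).
move=> I0 ID IM; split=> [|p q|a p].
- exact/genI.
- by rewrite !genI; apply: ID.
- by rewrite !genI; apply: IM.
Qed.

Lemma monomial_supportP I p : monomial_ideal I ->
  I p <-> supported_on (fun m => I 'X_[m]) p.
Proof.
move=> monI; split=> [Ip m pm|]; last first.
  by apply: ideal_supportP; apply: monomial_ideal_is_ideal.
case: monI => G /monomials_generateP genI; move/genI: Ip => /(_ m pm) Gm.
by apply/genI => m' /mem_msuppXP <-.
Qed.

Definition minimal_monomial I m :=
  I 'X_[m] /\ forall m', I 'X_[m'] -> (m' <= m)%MM -> m' = m.

(** Divisibility of monomials is well founded, so each monomial of [I] has a
    divisor in [I] of least degree, which is minimal; and a minimal monomial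
    cannot be left out of any set of generators. *)
Lemma minimal_monomial_gens I :
  monomial_ideal I -> min_monomial_gens I (minimal_monomial I).
Proof.
move=> monI; have idI := monomial_ideal_is_ideal monI.
split=> [|G' sub /monomials_generateP genI m [Im minm]].
  apply/monomials_generateP => p; rewrite (monomial_supportP p monI).
  split=> Ip m /Ip; last by case=> g [Ig _] legm; apply: ideal_mpolyX_le Ig.
  move=> Im.
  have [g [Ig legm] ming] := @ex_minimizer _
    (fun g => I 'X_[g] /\ (g <= m)%MM) mdeg (ex_intro _ m (conj Im (lepm_refl m))).
  exists g => //; split=> // g' Ig' leg'g; have leg'm := lepm_trans leg'g legm.
  move: (ming g' (conj Ig' leg'm)); rewrite -(submK leg'g) mdegD -{2}[mdeg g']add0n.
  by rewrite leq_add2r leqn0 mdeg_eq0 => /eqP ->; rewrite add0m.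
have [g G'g legm] : exists2 g, G' g & (g <= m)%MM.
  by have /genI := Im; apply; rewrite msuppX inE.
by have [Ig _] := sub g G'g; rewrite -(minm g Ig legm).
Qed.

(** The variables indexed by C become units, so their exponents no longer
    restrict membership; as the localization is an ideal of the whole ring, the
    witness [m'] may have arbitrarily large exponents there. *)
Lemma monomial_localizationP I (C : {set 'I_n}) p : monomial_ideal I ->
  monomial_localization I C p <->
  supported_on (fun m => exists2 m', I 'X_[m'] &
    forall i, i \notin C -> (m' i <= m i)%N) p.
Proof.
move=> monI.
pose del m : 'X_{1..n} := [multinom (if i \in C then 0 else m i)%N | i < n].
have substX m : 'X_[m] \mPo [tuple (if i \in C then 1 else 'X_i : S) | i < n]
    = 'X_[del m].
  rewrite comp_mpolyX mpolyXE_id; apply: eq_bigr => i _.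
  by rewrite tnth_mktuple mnmE; case: ifP; rewrite ?expr1n ?expr0.
split=> [Lp|suppp].
  apply: Lp => [|q [{}p Ip ->] m].
    apply: supported_on_ideal => m1 m2 /mnm_lepP le12 [m' Im' lem'].
    by exists m' => // i /lem'/leq_trans; apply.
  rewrite comp_mpolyEX => /msupp_sum_le; rewrite filter_predT.
  case/flatten_mapP => m' pm' /msuppZ_le; rewrite substX => /mem_msuppXP <-.
  exists m'; first by move/(monomial_supportP p monI): Ip; apply.
  by move=> i /negPf iC; rewrite mnmE iC.
have idL : is_ideal (monomial_localization I C) by apply: ideal_gen_is_ideal.
apply: (ideal_supportP idL) => m /suppp [m' Im' lem'm].
apply: (ideal_mpolyX_le (m := del m') idL).
  by apply/mnm_lepP => i; rewrite mnmE; case: ifPn => [|/lem'm].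
by move=> J _; apply; exists 'X_[m'] => //; rewrite substX.
Qed.
End Ideals.

(** * Exponents in two variables *)

Section TwoVariables.
Implicit Type m : 'X_{1..2}.

Lemma forall_I2 (P : 'I_2 -> Prop) : P ord0 -> P ord_max -> forall i, P i.
Proof.
move=> P0 P1; case=> [[|[|//]] lti].
  by rewrite (_ : Ordinal lti = ord0) //; apply: val_inj.
by rewrite (_ : Ordinal lti = ord_max) //; apply: val_inj.
Qed.

Lemma mnm2P m m' : m ord0 = m' ord0 -> m ord_max = m' ord_max -> m = m'.
Proof. by move=> ? ?; apply/mnmP; apply: forall_I2. Qed.

Lemma lem2E m m' :
  (m <= m')%MM = (m ord0 <= m' ord0)%N && (m ord_max <= m' ord_max)%N.
Proof.
apply/mnm_lepP/andP => [H|[H0 H1]]; first by split; apply: H.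
exact: forall_I2.
Qed.

Lemma mdeg2E m : mdeg m = (m ord0 + m ord_max)%N.
Proof.
rewrite mdegE !big_ord_recl big_ord0 addn0; congr (_ + m _)%N.
exact: val_inj.
Qed.

Definition mnm2 a b : 'X_{1..2} := (U_(ord0) *+ a + U_(ord_max) *+ b)%MM.

Lemma mnm2E0 a b : mnm2 a b ord0 = a.
Proof. by rewrite mnmDE !mulmnE !mnm1E mul1n addn0. Qed.

Lemma mnm2E1 a b : mnm2 a b ord_max = b.
Proof. by rewrite mnmDE !mulmnE !mnm1E mul1n. Qed.

Definition mnm2E := (mnm2E0, mnm2E1).
End TwoVariables.

(** * Homogeneous parts of vectors over a graded free module *)

Section GradedParts.
Variables (n : nat) (K : fieldType).
Local Notation S := {mpoly K[n]}.
Implicit Types (p q : S) (m : 'X_{1..n}) (a b j : int).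

(** The degree [j] part of an element of the free module S(-a) of rank one, whose
    generator has degree [a]. *)
Definition twisted_part a j : S -> S :=
  mrestrict (fun m => (mdeg m)%:Z + a == j).

Lemma mcoeff_twisted_part a j p m :
  (twisted_part a j p)@_m = if (mdeg m)%:Z + a == j then p@_m else 0.
Proof. exact: mcoeff_mrestrict. Qed.

Lemma twisted_partD a j : {morph twisted_part a j : p q / p + q}.
Proof.
move=> p q; apply/mpolyP => m; rewrite mcoeffD !mcoeff_twisted_part.
by case: ifP; rewrite ?mcoeffD ?addr0.
Qed.

Lemma twisted_partN a j : {morph twisted_part a j : p / - p}.
Proof.
move=> p; apply/mpolyP => m; rewrite mcoeffN !mcoeff_twisted_part.
by case: ifP; rewrite ?mcoeffN ?oppr0.
Qed.

Lemma twisted_part0 a j : twisted_part a j 0 = 0.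
Proof.
by apply/mpolyP => m; rewrite mcoeff_twisted_part mcoeff0 if_same.
Qed.

Lemma twisted_partM a b j p q :
    (forall m, m \in msupp q -> a = (mdeg m)%:Z + b) ->
  twisted_part b j (p * q) = twisted_part a j p * q.
Proof.
move=> homq; apply/mpolyP => m; rewrite mcoeff_twisted_part !mcoeffM.
case: ifP => degm.
  apply: eq_bigr => k /eqP mE; rewrite mcoeff_twisted_part.
  have [->|] := eqVneq (q@_k.2) 0; first by rewrite !mulr0.
  rewrite -mcoeff_msupp => /homq aE; rewrite ifT //.
  by rewrite aE addrA -PoszD -mdegD -mE.
symmetry; apply: big1 => k /eqP mE; rewrite mcoeff_twisted_part.
have [->|] := eqVneq (q@_k.2) 0; first by rewrite !mulr0.
rewrite -mcoeff_msupp => /homq aE; rewrite ifF ?mul0r //.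
by rewrite aE addrA -PoszD -mdegD -mE.
Qed.

Lemma twisted_part_homog e p : p \is e.-homog -> twisted_part 0 e%:Z p = p.
Proof.
move/dhomogP => homp; apply/mpolyP => m; rewrite mcoeff_twisted_part.
have [/homp|] := boolP (m \in msupp p); first by move=> ->; rewrite addr0 eqxx.
by rewrite -mcoeff_eq0 => /eqP ->; rewrite if_same.
Qed.

Definition row_part r (s : 'I_r -> int) j (v : 'rV[S]_r) : 'rV[S]_r :=
  \row_k twisted_part (s k) j (v 0 k).

Lemma row_partB r (s : 'I_r -> int) j v w :
  row_part s j (v - w) = row_part s j v - row_part s j w.
Proof. by apply/rowP => k; rewrite !mxE twisted_partD twisted_partN. Qed.

Lemma row_part_mulmx r c (s : 'I_r -> int) (t : 'I_c -> int) (A : 'M[S]_(r, c))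
    j v :
    (forall k l m, m \in msupp (A k l) -> s k = (mdeg m)%:Z + t l) ->
  row_part t j (v *m A) = row_part s j v *m A.
Proof.
move=> homA; apply/rowP => l; rewrite !mxE.
rewrite (big_morph _ (twisted_partD _ _) (twisted_part0 _ _)).
by apply: eq_bigr => k _; rewrite mxE; apply: twisted_partM => m /homA.
Qed.

Lemma row_part_scale r (s : 'I_r -> int) j i v :
  row_part s (j + 1) ('X_i *: v) = 'X_i *: row_part s j v.
Proof.
apply/rowP => k; rewrite !mxE mulrC (@twisted_partM (s k + 1)).
  rewrite mulrC; congr (_ * _); apply/mpolyP => m.
  by rewrite !mcoeff_twisted_part addrA (inj_eq (addIr 1)).
by move=> m /mem_msuppXP <-; rewrite mdeg1 addrC.
Qed.

Lemma row_part_id r (s : 'I_r -> int) j v :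
  row_part s j (row_part s j v) = row_part s j v.
Proof.
apply/rowP => k; rewrite !mxE; apply/mpolyP => m; rewrite !mcoeff_twisted_part.
by case: (_ == j).
Qed.
End GradedParts.

(** * Consequences of the vanishing of Tor *)

Section MinimalLifting.
Variables (n : nat) (K : fieldType).
Local Notation S := {mpoly K[n]}.

(** When a homogeneous element [v] of F_i becomes a cycle modulo the variables,
    the vanishing of homology makes it a boundary there; lifting the preimage to
    constant polynomials changes [v] by a boundary into an element all of whose
    coordinates vanish at the origin. *)
Lemma tor_lift (F : gfree_complex n K) i j (v : 'rV[S]_(grank F i)) :
    thomology_eq0 F i j -> row_part (@gshift _ _ F i) j v = v ->
    tcycle (map_mx (mcoeff 0%MM) v) ->
  exists w, forall k, ((v - w *m gdiff F i) 0 k)@_0%MM = 0.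
Proof.
move=> tor0 homv cycv.
have [|w _ vE] := tor0 (map_mx (mcoeff 0%MM) v) _ cycv.
  move=> k /negPf nekj; rewrite mxE -homv mxE mcoeff_twisted_part mdeg0 add0r.
  by rewrite nekj.
exists (map_mx (@mpolyC n K) w).
have /rowP const0 : map_mx (mcoeff 0%MM) (v - map_mx (@mpolyC n K) w *m gdiff F i) = 0.
  rewrite map_mxB map_mxM -map_mx_comp (eq_map_mx _ (@mpolyCK n K)).
  by apply/eqP; rewrite subr_eq0 map_mx_id //; apply/eqP.
by move=> k; move: (const0 k); rewrite !mxE.
Qed.
End MinimalLifting.

Lemma const0_split (K : fieldType) r (v : 'rV[{mpoly K[2]}]_r) :
    (forall k, (v 0 k)@_0%MM = 0) ->
  exists v0 v1, v = 'X_ord0 *: v0 + 'X_ord_max *: v1.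
Proof.
move=> v0; have splitk k : exists pq : {mpoly K[2]} * {mpoly K[2]},
    v 0 k = 'X_ord0 * pq.1 + 'X_ord_max * pq.2.
  (* The terms divisible by X go to the first summand, all others to the second. *)
  set P := fun m : 'X_{1..2} => m ord0 != 0%N.
  have [p pE] : exists p, mrestrict P (v 0 k) = 'X_ord0 * p.
    apply: mpolyX_dvd => m; rewrite mcoeff_msupp mcoeff_mrestrict lep1mP.
    by case: ifP; rewrite ?eqxx.
  have [q qE] : exists q, mrestrict (predC P) (v 0 k) = 'X_ord_max * q.
    apply: mpolyX_dvd => m; rewrite mcoeff_msupp mcoeff_mrestrict /= lep1mP.
    case: ifP; rewrite ?eqxx // /P negbK => /eqP m0 vm.
    apply: contraNneq vm => m1; suff -> : m = 0%MM by rewrite v0.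
    by apply: mnm2P; rewrite mnm0E.
  exists (p, q); rewrite /= -pE -qE; apply/mpolyP => m.
  by rewrite mcoeffD !mcoeff_mrestrict /=; case: (P m); rewrite ?addr0 ?add0r.
have [f fE] := fin_all_exists splitk.
exists (\row_k (f k).1), (\row_k (f k).2); apply/rowP => k.
by rewrite !mxE fE.
Qed.

Section TorVanishing.
Variable K : fieldType.
Local Notation S := {mpoly K[2]}.
Implicit Types (L : S -> Prop) (p q s : S).

Lemma resolution_aug_part (F : gfree_complex 2 K) L e (v : 'rV[S]_(grank F 0)) p :
    gfree_resolution F L -> p \is e.-homog -> p = (v *m gaug F) 0 0 ->
  p = (row_part (@gshift _ _ F 0) e%:Z v *m gaug F) 0 0.
Proof.
case=> _ homA _ _ _ homp pE; rewrite -(row_part_mulmx (t := fun=> 0)).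
  by rewrite mxE -pE twisted_part_homog.
by move=> k l m; rewrite ord1 addr0; apply: homA.
Qed.

(** Write [p] as the image of a vector of F_0 of degree [e]. By [tor_lift] its
    coordinates may be assumed to have no constant term, so they lie in the ideal
    generated by the variables. *)
Lemma Tor0_eq0_gens L e p :
    Tor_eq0 L 0 e%:Z -> p \is e.-homog -> L p ->
  exists p0 p1, [/\ L p0, L p1 & p = 'X_ord0 * p0 + 'X_ord_max * p1].
Proof.
case=> F resF tor0 homp Lp; have [_ _ imA kerA _] := resF.
have [v pE0] := (imA p).1 Lp; have pE := resolution_aug_part resF homp pE0.
set v' := row_part _ _ _ in pE.
have [||w /const0_split [v0 [v1 vE]]] := tor_lift (v := v') tor0 => //.
  exact: row_part_id.
exists ((v0 *m gaug F) 0 0), ((v1 *m gaug F) 0 0).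
split; [by apply/imA; exists v0|by apply/imA; exists v1|].
have kerw : w *m gdiff F 0 *m gaug F = 0 by apply/kerA; exists w.
rewrite pE -[v'](subrK (w *m gdiff F 0)) vE !mulmxDl kerw addr0 -!scalemxAl.
by rewrite !mxE.
Qed.

(** Lift X s and Y s to vectors [v] and [w] of F_0 of degree [e.+1]. Then
    Y v - X w maps to 0, hence comes from some [z] in F_1 of degree [e.+2]. As
    Y v - X w vanishes modulo the variables, [z] is a cycle there, and by
    [tor_lift] it may be taken of the form X z1 + Y z2. Thus
    Y (v - d z2) = X (w + d z1), so v - d z2 is X times a vector, whose image
    is s. *)
Lemma Tor1_eq0_socle L e s :
    Tor_eq0 L 1 (e.+2)%:Z -> s \is e.-homog ->
  L ('X_ord0 * s) -> L ('X_ord_max * s) -> L s.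
Proof.
case=> F resF tor0 homs L0 L1; have [homD _ imA kerA kerD] := resF.
have homX i : 'X_i * s \is e.+1.-homog.
  by apply: (dhomogM (d := 1) _ homs); rewrite dhomogX; apply/eqP/mdeg1.
have augL p : p \is e.+1.-homog -> L p -> exists2 v,
    row_part (@gshift _ _ F 0) e.+1%:Z v = v & v *m gaug F = p%:M.
  move=> homp /imA [v /(resolution_aug_part resF homp) pE].
  exists (row_part (@gshift _ _ F 0) e.+1%:Z v); rewrite ?row_part_id //.
  by rewrite [LHS]mx11_scalar -pE.
have [v homv vE] := augL _ (homX _) L0; have [w homw wE] := augL _ (homX _) L1.
pose u := 'X_ord_max *: v - 'X_ord0 *: w.
have [z0 uE0] : exists z, u = z *m gdiff F 0.
  by apply/kerA; rewrite mulmxBl -!scalemxAl vE wE !scale_scalar_mx mulrCA subrr.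
pose z := row_part (@gshift _ _ F 1) e.+2%:Z z0.
have uE : u = z *m gdiff F 0.
  rewrite -(row_part_mulmx (t := @gshift _ _ F 0)); last exact: homD.
  by rewrite -uE0 row_partB -[e.+2]addn1 PoszD !row_part_scale homv homw.
have [||w1 /const0_split [z1 [z2 zE]]] := tor_lift (v := z) tor0.
- exact: row_part_id.
- rewrite /= /tdiff -map_mxM -uE /u; apply/rowP => k.
  by rewrite !mxE rmorphB !rmorphM /= !mcoeffX !mnm1_eq0 !mul0r subrr.
have {}uE : u = 'X_ord0 *: (z1 *m gdiff F 0) + 'X_ord_max *: (z2 *m gdiff F 0).
  have ker1 : w1 *m gdiff F 1 *m gdiff F 0 = 0 by apply/kerD; exists w1.
  by rewrite !scalemxAl -mulmxDl -zE mulmxBl ker1 subr0.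
have eqX : 'X_ord_max *: (v - z2 *m gdiff F 0) = 'X_ord0 *: (w + z1 *m gdiff F 0).
  apply/eqP; rewrite scalerBr scalerDr subr_eq -addrA -uE /u addrCA addrN addr0.
  by [].
have cofactor k : exists t, (v - z2 *m gdiff F 0) 0 k = 'X_ord0 * t.
  have /rowP/(_ k) := eqX; rewrite mxE [RHS]mxE.
  case/mpolyX_coprime_cofactor => [i|t tE _]; last by exists t.
  by move: i; apply: forall_I2; rewrite !mnm1E.
have [f fE] := fin_all_exists cofactor; apply/imA; exists (\row_k f k).
apply: (mulfI (mpolyX_neq0 K U_(ord0))).
have -> : 'X_ord0 * ((\row_k f k) *m gaug F) 0 0
    = ((v - z2 *m gdiff F 0) *m gaug F) 0 0.
  suff -> : v - z2 *m gdiff F 0 = 'X_ord0 *: \row_k f k by rewrite -scalemxAl !mxE.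
  by apply/rowP => k; rewrite fE !mxE.
have kerz : z2 *m gdiff F 0 *m gaug F = 0 by apply/kerA; exists z2.
by rewrite mulmxBl kerz subr0 vE mxE eqxx mulr1n.
Qed.
End TorVanishing.

(** * Linear resolutions of the ideals X^a Y^b (X, Y)^r *)

Section Resolution.
Variable K : fieldType.
Local Notation S := {mpoly K[2]}.
Local Notation X := ('X_ord0 : S).
Local Notation Y := ('X_ord_max : S).
Implicit Types (L : S -> Prop) (w v : nat -> S) (a b r : nat).

Lemma linear_resolution_ext L L' :
  (forall p, L p <-> L' p) -> linear_resolution L -> linear_resolution L'.
Proof.
move=> eqL [d linL]; exists d => i j /linL [F [? ? imA ? ?] tor0].
by exists F => //; split=> // p; rewrite -eqL.
Qed.

(** Each F_i (x) K then lives in degree i + d only, so its homology vanishes in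
    all other degrees, whatever the differential. *)
Lemma linear_resolution_intro L (F : gfree_complex 2 K) (d : int) :
    gfree_resolution F L ->
    (forall i (k : 'I_(grank F i)), gshift k = i%:Z + d) ->
  linear_resolution L.
Proof.
move=> resF shiftF; exists d => i j nej; exists F => // v degv _; exists 0.
  by move=> k _; rewrite mxE.
rewrite mul0mx; apply/rowP => k; rewrite mxE degv // shiftF eq_sym.
exact: nej.
Qed.

Definition zero_complex : gfree_complex 2 K :=
  @GFreeComplex 2 K (fun=> 0%N) (fun _ _ => 0) (fun=> 0) 0.

Lemma linear_resolution0 L : (forall p, L p <-> p = 0) -> linear_resolution L.
Proof.
move=> L0; apply: (linear_resolution_intro (F := zero_complex) (d := 0)) => [|i []//].
split=> [i []//|[]//|p|v|i v]; last first.
- by rewrite (thinmx0 v); split=> _; [exists 0|]; rewrite mul0mx.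
- by rewrite (thinmx0 v); split=> _; [exists 0|]; rewrite mul0mx.
- rewrite L0; split=> [->|[v ->]]; first by exists 0; rewrite mul0mx mxE.
  by rewrite /= mulmx0 mxE.
Qed.

(** Exactness at F_0: the syzygies of Y^r, X Y^(r-1), ..., X^r are generated by
    those between neighbours. By induction on [r]: all terms but the last are
    divisible by Y, so the last coefficient is, and a multiple of the last
    neighbour relation removes it; what remains is Y times a syzygy of the powers
    of degree [r - 1]. The coefficients [w] of the relations are indexed from 1,
    with zeros at both ends, so that one formula covers all positions. *)
Lemma linear_syzygies r v :
    \sum_(k < r.+1) v k * X ^+ k * Y ^+ (r - k) = 0 ->
  exists w, [/\ w 0 = 0, w r.+1 = 0 &
    forall k, (k <= r)%N -> v k = X * w k.+1 - Y * w k].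
Proof.
elim: r v => [|r IHr] v.
  rewrite big_ord1 subnn !expr0 !mulr1 => v0.
  by exists (fun=> 0); split=> // -[|//] _; rewrite v0 !mulr0 subrr.
rewrite big_ord_recr /= subnn expr0 mulr1 => sum0.
have {}sum0 : Y * (\sum_(k < r.+1) v k * X ^+ k * Y ^+ (r - k))
    = X ^+ r.+1 * - v r.+1.
  apply/eqP; rewrite mulrN -addr_eq0 [X ^+ _ * _]mulrC -[X in _ == X]sum0.
  apply/eqP; congr (_ + _); rewrite mulr_sumr; apply: eq_bigr => k _.
  by rewrite subSn ?(leq_ord k) // exprS mulrCA.
have [t sumE vE] : exists2 t,
    \sum_(k < r.+1) v k * X ^+ k * Y ^+ (r - k) = X ^+ r.+1 * t &
    - v r.+1 = Y * t.
  move: sum0; rewrite mpolyXn; apply: mpolyX_coprime_cofactor.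
  by apply: forall_I2; rewrite mulmnE !mnm1E.
(* Subtracting [t] times the last neighbour relation removes position [r.+1]. *)
pose v' k := if k == r then v r - X * t else v k.
have /IHr [w [w0 wr wE]] : \sum_(k < r.+1) v' k * X ^+ k * Y ^+ (r - k) = 0.
  apply: etrans (subrr (X ^+ r.+1 * t)); rewrite -{1}sumE !big_ord_recr /= -addrA.
  rewrite /v' /= eqxx subnn expr0 !mulr1 mulrBl exprSr -!mulrA [t * _]mulrC.
  rewrite [X * (_ * t)]mulrCA; congr (_ + _); apply: eq_bigr => k _.
  by rewrite ltn_eqF.
exists (fun k => if k == r.+1 then t else if k == r.+2 then 0 else w k).
split=> [//||k]; first by rewrite eqn_leq ltnn eqxx.
rewrite leq_eqVlt eqSS => /predU1P [->|]; last rewrite ltnS leq_eqVlt.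
  rewrite eqxx !eqn_leq ltnn /= ltnn leqnn mulr0 sub0r.
  by rewrite -vE opprK.
case/predU1P => [->|ltkr].
  rewrite eqxx; have := wE r (leqnn r); rewrite /v' eqxx wr mulr0 sub0r => wE'.
  rewrite -[v r](subrK (X * t)) wE' ltn_eqF // ltn_eqF ?ltnS //.
  by rewrite addrC.
have := wE k (ltnW ltkr); rewrite /v' ltn_eqF // => ->.
by rewrite !ifN // neq_ltn; apply/orP; left; lia.
Qed.

Definition power_rank r i := match i with 0 => r.+1 | 1 => r | _ => 0 end%N.

Definition power_diff r i : 'M[S]_(power_rank r i.+1, power_rank r i) :=
  match i with
  | 0 => \matrix_(k < r, l < r.+1) (X *+ (l == k :> nat) - Y *+ (l == k.+1 :> nat))
  | _ => 0
  end.

Definition power_gen a b r k := mnm2 (a + k) (b + (r - k)).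

(** The complex 0 -> S(-d-1)^r -> S(-d)^(r+1) -> X^a Y^b (X, Y)^r, d = a + b + r. *)
Definition power_complex a b r : gfree_complex 2 K :=
  @GFreeComplex 2 K (power_rank r) (fun i _ => i%:Z + (a + b + r)%:Z)
    (power_diff r) (\col_(k < r.+1) 'X_[power_gen a b r k]).

(** Extends a vector by zeros on both sides, in the indexing of
    [linear_syzygies]. *)
Definition pad r (W : 'rV[S]_r) (k : nat) : S :=
  if k is k'.+1 then oapp (W 0) 0 (insub k') else 0.

Lemma power_diffE r (W : 'rV[S]_r) (l : 'I_r.+1) :
  (W *m power_diff r 0) 0 l = X * pad W l.+1 - Y * pad W l.
Proof.
rewrite mxE.
transitivity (\sum_(k < r) (if k == l :> nat then X * pad W k.+1 else 0)
  - \sum_(k < r) (if k.+1 == l :> nat then Y * pad W k.+1 else 0)).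
  rewrite -sumrB; apply: eq_bigr => k _; rewrite !mxE /= valK /= mulrBr.
  rewrite ![l == _ :> nat]eq_sym ![_ * W 0 k]mulrC.
  by do 2!case: eqP => _; rewrite ?mulr0n ?mulr1n ?mulr0.
congr (_ - _).
  rewrite -big_mkcond (big_ord1_eq _ (fun k => X * pad W k.+1)) /=.
  by case: ltnP => // ler; rewrite insubF ?mulr0 // ltnNge ler.
case: l => [[|l] ltlr] /=; first by rewrite big1 // mulr0.
rewrite -big_mkcond (eq_bigl (fun k : 'I_r => k == l :> nat)) //.
rewrite (big_ord1_eq _ (fun k => Y * pad W k.+1)) /=.
by case: ltnP => // ler; rewrite insubF ?mulr0 // ltnNge ler.
Qed.

Lemma power_augE a b r v :
  \sum_(k < r.+1) v k * 'X_[power_gen a b r k]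
  = 'X_[mnm2 a b] * \sum_(k < r.+1) v k * X ^+ k * Y ^+ (r - k).
Proof.
rewrite mulr_sumr; apply: eq_bigr => k _; rewrite -mulrA mulrCA; congr (_ * _).
rewrite !mpolyXn -!mpolyXD; congr 'X_[_].
by apply: mnm2P; rewrite /power_gen !(mnmDE, mulmnE, mnm1E) /=; lia.
Qed.

(** The monomials of X^a Y^b (X, Y)^r are exactly the ones satisfying these three
    inequalities; in this form localizations are immediate. *)
Definition power_ideal a b r : S -> Prop :=
  supported_on (fun m =>
    [/\ (a <= m ord0)%N, (b <= m ord_max)%N & (a + b + r <= mdeg m)%N]).

Lemma power_idealE a b r p :
  power_ideal a b r p <->
  exists v : 'rV[S]_r.+1, p = (v *m \col_(k < r.+1) 'X_[power_gen a b r k]) 0 0.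
Proof.
have idP : is_ideal (power_ideal a b r).
  apply: supported_on_ideal => m m'; rewrite lem2E !mdeg2E => /andP [? ?] [? ? ?].
  by split; lia.
split=> [Pp|[v ->]]; last first.
  rewrite mxE; apply: ideal_sum => // k _; case: (idP) => _ _; apply.
  rewrite mxE => m /mem_msuppXP <-; rewrite mdeg2E !mnm2E.
  by have := ltn_ord k; split; lia.
have idE : is_ideal (fun p => exists v : 'rV[S]_r.+1,
    p = (v *m \col_(k < r.+1) 'X_[power_gen a b r k]) 0 0).
  split=> [|p1 p2 [v1 ->] [v2 ->]|c p1 [v1 ->]].
  - by exists 0; rewrite mul0mx mxE.
  - by exists (v1 + v2); rewrite mulmxDl [RHS]mxE.
  - by exists (c *: v1); rewrite -scalemxAl [RHS]mxE.
apply: (ideal_supportP idE) => m /Pp []; rewrite mdeg2E => am bm rm.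
pose k := minn r (m ord0 - a); have ltkr : (k < r.+1)%N by lia.
apply: (ideal_mpolyX_le (m := power_gen a b r k) idE).
  by rewrite lem2E !mnm2E; lia.
exists (delta_mx 0 (Ordinal ltkr)); rewrite -rowE.
by rewrite !mxE.
Qed.

(** Applied to a vector, the differential telescopes under the augmentation; it is
    injective because the first [r] columns of its matrix form a triangular matrix
    with X on the diagonal. *)
Lemma power_complex_resolution a b r :
  gfree_resolution (power_complex a b r) (power_ideal a b r).
Proof.
split=> [[|i] k l m|k m|p|v|i v] /=.
- have degX (i : 'I_2) (e : bool) : m \in msupp ('X_i *+ e : S) -> mdeg m = 1%N.
    case: e; rewrite ?mulr1n ?mulr0n; last by rewrite -mpolyC0 msupp0.
    by move/mem_msuppXP <-; rewrite mdeg1.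
  by rewrite mxE => /msuppB_le; rewrite mem_cat => /orP [] /degX ->.
- by case: k.
- rewrite mxE => /mem_msuppXP <-; rewrite mdeg2E !mnm2E.
  by rewrite add0r; congr Posz; have := leq_ord k; lia.
- exact: power_idealE.
- have augE : (v *m \col_(k < r.+1) 'X_[power_gen a b r k]) 0 0 =
      'X_[mnm2 a b] * \sum_(k < r.+1) v 0 (inord k) * X ^+ k * Y ^+ (r - k).
    rewrite -(power_augE a b r (fun k => v 0 (inord k))) mxE.
    by apply: eq_bigr => k _; rewrite mxE inord_val.
  split=> [kerv|[w vE]].
    have [|w [w0 wr wE]] := @linear_syzygies r (fun k => v 0 (inord k)).
      apply: (mulfI (mpolyX_neq0 K (mnm2 a b))).
      by rewrite -augE kerv mxE mulr0.
    exists (\row_(k < r) w k.+1); apply/rowP => l.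
    rewrite power_diffE -[in LHS](inord_val l) wE ?leq_ord //.
    suff padE k : (k <= r.+1)%N -> pad (\row_(k < r) w k.+1) k = w k.
      by rewrite !padE // ltnW.
    case: k => [|k] //; rewrite ltnS /= leq_eqVlt => /predU1P [->|ltkr].
      by rewrite insubF ?ltnn.
    by rewrite insubT /= mxE.
  apply/matrixP => i j; rewrite !ord1 augE mxE.
  pose f k := pad w k * X ^+ k * Y ^+ (r.+1 - k).
  rewrite (eq_bigr (fun k : 'I_r.+1 => f k.+1 - f k)) => [|k _].
    rewrite -(big_mkord predT (fun k => f k.+1 - f k)) telescope_sumr // /f.
    by rewrite /= insubF ?ltnn //= !mul0r subrr mulr0.
  rewrite inord_val vE power_diffE /f subSS !mulrBl exprS subSn ?(leq_ord k) // exprS.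
  congr (_ - _); first by rewrite !mulrA [X * _]mulrC.
  by rewrite -!mulrA mulrC -!mulrA [_ * Y]mulrC.
- split=> [kerv|[w ->]]; last by rewrite mulmx0 mul0mx.
  exists 0; rewrite mul0mx; case: i v kerv => [|i] v kerv; last exact: thinmx0.
  have pad0 k : (k <= r.+1)%N -> pad v k = 0.
    elim: k => // k IHk ltkr; have /rowP/(_ (Ordinal ltkr)) := kerv.
    rewrite power_diffE /= IHk ?(ltnW ltkr) // mulr0 subr0 mxE => /eqP.
    by rewrite mulf_eq0 (negPf (mpolyX_neq0 _ _)) => /eqP.
  apply/rowP => k; rewrite mxE -(pad0 k.+1) ?ltnS 1?ltnW //.
  by rewrite /= valK.
Qed.

Lemma power_ideal_linear a b r : linear_resolution (power_ideal a b r).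
Proof. exact: (linear_resolution_intro (power_complex_resolution a b r)). Qed.
End Resolution.

(** * Polymatroidal ideals in two variables *)

Section Classification.
Variable K : fieldType.
Local Notation S := {mpoly K[2]}.
Implicit Types (I : S -> Prop) (m u v w g : 'X_{1..2}).

(** If [u] and [w] are the generators of least and of largest X-exponent, the
    exchange property relative to [u] lowers an X-exponent exceeding that of [u]
    by one, so it leads from [w] through all the monomials in between. *)
Lemma polymatroidal_power I : polymatroidal I ->
  (forall p, I p <-> p = 0) \/
  exists a b r, forall p, I p <-> power_ideal a b r p.
Proof.
case=> G minG [eqdeg exch]; have /monomials_generateP genI := minG.1.
have [[g0 Gg0]|noG] := classic (exists g, G g); last first.
  left=> p; rewrite genI; split=> [p0|->]; last first.
    by move=> m; rewrite -mpolyC0 msupp0.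
  apply/eqP; rewrite -msupp_eq0; case E: (msupp p) => [//|m s].
  by have [|g Gg] := p0 m; [rewrite E mem_head|case: noG; exists g].
right.
have memX m : I 'X_[m] <-> exists2 g, G g & (g <= m)%MM.
  rewrite genI; split=> [/(_ m)|Im m' /mem_msuppXP <- //].
  by apply; apply/mem_msuppXP.
have [u Gu minu] := ex_minimizer (fun m => m ord0) (ex_intro _ g0 Gg0).
have [w Gw minw] := ex_minimizer (fun m => m ord_max) (ex_intro _ g0 Gg0).
have uw := eqdeg _ _ Gu Gw; rewrite !mdeg2E in uw.
have := minu w Gw; have := minw u Gu => w1u1 u0w0.
have memG m : mdeg m = mdeg u -> I 'X_[m] -> G m.
  move=> degm /memX [g Gg]; rewrite lem2E => /andP [le0 le1].
  have := eqdeg _ _ Gg Gu; rewrite !mdeg2E in degm *.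
  by move=> degg; rewrite (_ : m = g) //; apply: mnm2P; lia.
(* Induction on the distance from [w], the generator of largest X-exponent. *)
have between k m : (w ord0 - m ord0 <= k)%N -> (u ord0 <= m ord0)%N ->
    (w ord_max <= m ord_max)%N -> mdeg m = mdeg u -> G m.
  elim: k m => [|k IHk] m lek lem0 lem1 degm; rewrite !mdeg2E in degm.
    by rewrite (_ : m = w) //; apply: mnm2P; lia.
  have [lewm|ltmw] := leqP (w ord0) (m ord0).
    by rewrite (_ : m = w) //; apply: mnm2P; lia.
  pose m' := mnm2 (m ord0).+1 (m ord_max).-1.
  have Gm' : G m' by apply: IHk; rewrite ?mdeg2E !mnm2E; lia.
  (* [m'] and [u] have equal degrees, so only Y can be the exchanged variable. *)
  have [|] := exch _ _ Gm' Gu ord0; first by rewrite mnm2E; lia.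
  apply: forall_I2; first by rewrite mnm2E; lia.
  move=> _ Im; apply: memG; first by rewrite !mdeg2E.
  rewrite (_ : m = (U_(ord_max) + (m' - U_(ord0)))%MM) //.
  by apply: mnm2P; rewrite mnmDE mnmBE !mnm1E mnm2E /=; lia.
exists (u ord0), (w ord_max), (mdeg u - u ord0 - w ord_max)%N => p.
rewrite genI; split=> suppp m /suppp.
  case=> g Gg; rewrite lem2E => /andP [le0 le1]; have := eqdeg _ _ Gg Gu.
  have := minu _ Gg; have := minw _ Gg; rewrite !mdeg2E.
  by split; lia.
case=> lem0 lem1; rewrite !mdeg2E => led.
pose m0 := minn (m ord0) (w ord0).
exists (mnm2 m0 (mdeg u - m0)); last by rewrite lem2E !mnm2E mdeg2E; lia.
by apply: (between (w ord0)); rewrite !mdeg2E ?mnm2E; lia.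
Qed.

Lemma power_ideal_localization I a b r (C : {set 'I_2}) :
    monomial_ideal I -> (forall p, I p <-> power_ideal a b r p) ->
  exists a' b' r', forall p,
    monomial_localization I C p <-> power_ideal a' b' r' p.
Proof.
move=> monI IP.
have memX m : I 'X_[m] <->
    [/\ (a <= m ord0)%N, (b <= m ord_max)%N & (a + b + r <= mdeg m)%N].
  by rewrite IP; split=> [|Mm m' /mem_msuppXP <- //]; apply; apply/mem_msuppXP.
suff [a' [b' [r' E]]] : exists a' b' r', forall m,
    (exists2 m', I 'X_[m'] & forall i, i \notin C -> (m' i <= m i)%N) <->
    [/\ (a' <= m ord0)%N, (b' <= m ord_max)%N & (a' + b' + r' <= mdeg m)%N].
  exists a', b', r' => p; rewrite monomial_localizationP //.
  by split=> suppp m /suppp /E.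
(* A variable made invertible also removes the degree bound. *)
exists (if ord0 \in C then 0 else a)%N, (if ord_max \in C then 0 else b)%N.
exists (if (ord0 \in C) || (ord_max \in C) then 0 else r)%N => m.
split=> [[m' /memX []]|[]]; rewrite !mdeg2E => H0 H1 H2.
  move=> lem'; move: (lem' ord0) (lem' ord_max).
  by do 2!case: (_ \in C) => /=; split; lia.
(* An exponent as large as [a + b + r] satisfies the conditions by itself. *)
exists (mnm2 (if ord0 \in C then a + b + r else m ord0)
             (if ord_max \in C then a + b + r else m ord_max))%N.
  apply/memX; rewrite mdeg2E !mnm2E.
  by move: H0 H1 H2; do 2!case: (_ \in C) => /=; split; lia.
by apply: forall_I2 => /= /negPf ->; rewrite mnm2E.
Qed.

(** A linear resolution puts all minimal generators in degree [d] through Tor_0,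
    and fills the gaps between them through Tor_1. *)
Lemma linear_polymatroidal I :
  monomial_ideal I -> linear_resolution I -> polymatroidal I.
Proof.
move=> monI [d linI]; have idI := monomial_ideal_is_ideal monI.
have upI m m' : (m <= m')%MM -> I 'X_[m] -> I 'X_[m'].
  exact: ideal_mpolyX_le.
have degG m : minimal_monomial I m -> (mdeg m)%:Z = d.
  case=> Im minm; apply/eqP/negPn/negP => nedeg.
  have [||p0 [p1 [Ip0 Ip1 mE]]] := @Tor0_eq0_gens _ _ (mdeg m) 'X_[m] _ _ Im.
  - by apply: linI; rewrite add0r.
  - by rewrite dhomogX.
  have supp i p : I p -> m \in msupp ('X_i * p) -> False.
    move=> Ip /msuppXM [m' pm' {}mE].
    have Im' : I 'X_[m'] by move/(monomial_supportP p monI): Ip; apply.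
    have := minm m' Im'; rewrite mE lem_addl => /(_ isT) /(congr1 (@mdeg 2)).
    by rewrite mdegD mdeg1; lia.
  have : m \in msupp ('X_[m] : S) by apply/mem_msuppXP.
  by rewrite mE => /msuppD_le; rewrite mem_cat => /orP [] /supp; apply.
(* Induction on how far the degree of [m] stays below that of lcm (u, v); from
   that degree on, u or v divides m. *)
have between k u v m :
    I 'X_[u] -> I 'X_[v] -> (mdeg u)%:Z = d -> (mdeg v)%:Z = d ->
    (minn (u ord0) (v ord0) <= m ord0)%N ->
    (minn (u ord_max) (v ord_max) <= m ord_max)%N -> (mdeg u <= mdeg m)%N ->
    (maxn (u ord0) (v ord0) + maxn (u ord_max) (v ord_max) <= mdeg m + k)%N ->
  I 'X_[m].
  move=> Iu Iv du dv; elim: k m => [|k IHk] m le0 le1 led lek.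
    have /orP [leum|levm] : (u <= m)%MM || (v <= m)%MM.
    - by rewrite !lem2E; rewrite !mdeg2E in led lek du dv; lia.
    - exact: upI leum Iu.
    - exact: upI levm Iv.
  (* Linearity leaves Tor_1 only in degree 1 + d, while mdeg m + 2 > 1 + d. *)
  apply: (@Tor1_eq0_socle _ _ (mdeg m)).
  - by apply: linI; lia.
  - by rewrite dhomogX.
  - by rewrite -mpolyXD; apply: IHk; rewrite ?mdegD ?mdeg1 ?mnmDE ?mnm1E /=; lia.
  - by rewrite -mpolyXD; apply: IHk; rewrite ?mdegD ?mdeg1 ?mnmDE ?mnm1E /=; lia.
exists (minimal_monomial I); first exact: minimal_monomial_gens.
split=> [u v /degG du /degG dv|u v Gu Gv]; first by lia.
have du := degG u Gu; have dv := degG v Gv.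
have := between (maxn (u ord0) (v ord0) + maxn (u ord_max) (v ord_max))%N u v
  _ Gu.1 Gv.1 du dv.
move: du dv; rewrite !mdeg2E => du dv btw.
apply: forall_I2 => lti; [exists ord_max|exists ord0]; try lia.
  by apply: btw; rewrite ?mdeg2E ?mnmDE ?mnmBE ?mnm1E /=; lia.
by apply: btw; rewrite ?mdeg2E ?mnmDE ?mnmBE ?mnm1E /=; lia.
Qed.
End Classification.

Theorem corollary2p5 (K : fieldType) (I : {mpoly K[2]} -> Prop)
    (I_monomial : monomial_ideal I) :
  (polymatroidal I <->
     forall C : {set 'I_2}, linear_resolution (monomial_localization I C)) /\
  ((forall C : {set 'I_2}, linear_resolution (monomial_localization I C)) <->
     linear_resolution I).
Proof.
have ab : polymatroidal I ->
    forall C : {set 'I_2}, linear_resolution (monomial_localization I C).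
  case/polymatroidal_power => [I0|[a [b [r IP]]]] C; last first.
    have [a' [b' [r' locE]]] := power_ideal_localization C I_monomial IP.
    apply: linear_resolution_ext (power_ideal_linear K a' b' r') => p.
    by rewrite locE.
  apply: linear_resolution0 => p; rewrite monomial_localizationP //.
  split=> [suppp|-> m]; last by rewrite -mpolyC0 msupp0.
  apply/eqP; rewrite -msupp_eq0; case E: (msupp p) => [//|m s].
  have [|m' /I0/eqP] := suppp m; first by rewrite E mem_head.
  by rewrite (negPf (mpolyX_neq0 _ _)).
have bc : (forall C : {set 'I_2}, linear_resolution (monomial_localization I C)) ->
    linear_resolution I.
  move/(_ set0); apply: linear_resolution_ext => p.
  rewrite monomial_localizationP // (monomial_supportP p I_monomial).
  split=> suppp m /suppp; last by exists m.
  case=> m' Im' lem'.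
  apply: ideal_mpolyX_le (monomial_ideal_is_ideal I_monomial) _ Im'.
  by apply/mnm_lepP => i; apply: lem'; rewrite inE.
have ca := linear_polymatroidal I_monomial.
by split; split; auto.
Qed.
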